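(* For $n \geq 1$ let $\mathcal{W}(n,n,n)$ be the set of words over the alphabet $\{1,2,3\}$ containing exactly $n$ occurrences of each of the letters $1$, $2$ and $3$, and let $X_n = gep(w)$ where $w$ is chosen uniformly at random from $\mathcal{W}(n,n,n)$. Let $\mu_n = E[X_n]$ and, for $r \geq 2$, let $m_r(n) = E[(X_n-\mu_n)^r]$ be the $r$-th moment about the mean. Then for all $n\ge 1$: $$\mu_n = \frac{n^3}{2}, \qquad m_2(n) = \frac{n^4}{4},$$ all odd moments about the mean $m_3(n), m_5(n), \dots$ are zero, and $$m_4(n) = \frac{1}{80} n^7 (21n-16),$$ $$m_6(n) = \frac{1}{448} n^9 \left(279 n^3 - 656 n^2 + 512 n - 128\right),$$ $$m_8(n) = \frac{1}{1280} n^{11}\left(3429 n^5 - 16480 n^4 + 32512 n^3 - 32512 n^2 + 16384 n - 3328\right),$$ $$m_{10}(n) = \frac{1}{11264} n^{13}(3n-4)\left(68985 n^6 - 469716 n^5 + 1391760 n^4 - 2251584 n^3 + 2072832 n^2 - 1022208 n + 209920\right),$$ $$m_{12}(n) = n^{15}\Big(\tfrac{343717911}{1863680} n^9 - \tfrac{265635477}{116480} n^8 + \tfrac{93771627}{7280} n^7 - \tfrac{45012561}{1040} n^6 + \tfrac{43093563}{455} n^5 - \tfrac{77940021}{560} n^4 + \tfrac{62196357}{455} n^3 - \tfrac{39213532}{455} n^2 + \tfrac{14354176}{455} n - \tfrac{463661}{91}\Big).$$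
   Context: For a word $w = w_1 w_2 \cdots w_m$ over a totally ordered alphabet, the Gepner statistic is $$gep(w) = \#\{(i,j,k) : 1 \le i < j < k \le m,\ w_i < w_k < w_j \text{ or } w_j < w_i < w_k \text{ or } w_k < w_j < w_i\},$$ i.e. the number of length-3 subsequences (positions $i<j<k$) whose letters are distinct and reduce to one of the odd permutations $132$, $213$, $321$. *)

(* Defs.v *)
From mathcomp Require Import all_boot all_order all_algebra.

Set Implicit Arguments.
Unset Strict Implicit.
Unset Printing Implicit Defensive.

Import Order.TTheory GRing.Theory Num.Theory.
Local Open Scope ring_scope.

(* The number of position triples carrying one of the odd patterns 132, 213, 321. *)
Definition gep (d : Order.disp_t) (A : orderType d) (m : nat)
    (w : m.-tuple A) : nat :=
  #|[set t : 'I_m * 'I_m * 'I_m |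
      let: (i, j, k) := t in
      let: (a, b, c) := (tnth w i, tnth w j, tnth w k) in
      [&& (i < j)%N, (j < k)%N &
          [|| (a < c)%O && (c < b)%O,
              (b < a)%O && (a < c)%O |
              (c < b)%O && (b < a)%O]]]|.

(* The letters 1 < 2 < 3 are encoded as the elements 0 < 1 < 2 of 'I_3. *)
Definition balanced_words (n : nat) : {set (3 * n).-tuple 'I_3} :=
  [set w : (3 * n).-tuple 'I_3 | [forall a : 'I_3, count_mem a w == n]].

Definition unif_mean (T : finType) (S : {set T}) (X : T -> rat) : rat :=
  (\sum_(x in S) X x) / #|S|%:R.

Definition gep_mean (n : nat) : rat :=
  unif_mean (balanced_words n) (fun w => (gep w)%:R).

Definition gep_moment (r n : nat) : rat :=
  unif_mean (balanced_words n) (fun w => ((gep w)%:R - gep_mean n) ^+ r).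

(* Main.v *)
(* Put T = A12 + A23 + A31, where Axy is the number of pairs of positions in
   which x precedes y minus the number in which y precedes x. Writing a, b, c for
   the numbers of 1s, 2s, 3s, every word satisfies
     2 gep = a b c - (c A12 + a A23 + b A31),
   so on balanced words gep - n^3 / 2 = - (n / 2) T. Reversing a word negates T,
   which kills the odd moments. Prepending a letter changes T by an amount that
   depends on (a, b, c) only, so the means M_r(a, b, c) of T^r over the words of
   content (a, b, c) satisfy
     (a + b + c) M_r(a, b, c) = a sum_j 'C(r, j) (b - c)^(r - j) M_j(a - 1, b, c)
                                + (two cyclic analogues).
   For r <= 12 they are the symmetric polynomials tabulated below, because the
   table satisfies the same recurrence; the theorem is their restriction to
   a = b = c = n. *)

From Stdlib Require Import ZArith.
From HB Require Import structures.
Require Import Defs.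
From mathcomp Require Import all_boot all_order all_algebra.
From mathcomp Require Import ring lra zify ssrZ.
Import GRing.Theory Num.Theory.
Local Open Scope ring_scope.

(** * The tabulated polynomials and their recurrence *)

(* [Term i j k z] stands for z e1^i e2^j e3^k, with e1, e2, e3 the elementary
   symmetric functions of (a, b, c). *)
Inductive term := Term (i j k : nat) (z : Z).

(* 135135 M_r(a, b, c), obtained by interpolating the values that the recurrence
   gives for small contents. M_r = 0 for odd r. *)
Definition moment_table (r : nat) : seq term :=
  match r with
  | 0 => [::
      Term 0 0 0 135135]
  | 2 => [::
      Term 0 0 1 (-405405); Term 0 1 0 45045; Term 1 1 0 45045]
  | 4 => [::
      Term 0 0 1 (-270270); Term 0 0 2 3648645; Term 0 1 1 (-2270268);
      Term 0 2 0 63063; Term 1 0 1 324324; Term 1 1 0 (-18018);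
      Term 1 1 1 (-810810); Term 1 2 0 108108; Term 2 0 1 594594;
      Term 2 1 0 (-36036); Term 2 2 0 45045; Term 3 1 0 (-18018)]
  | 6 => [::
      Term 0 0 1 (-2316600); Term 0 0 2 7992270; Term 0 0 3 (-54729675);
      Term 0 1 1 (-15405390); Term 0 1 2 83918835; Term 0 2 1 (-35154405);
      Term 0 3 0 199485; Term 1 0 1 3294720; Term 1 0 2 (-6254820);
      Term 1 1 0 (-17160); Term 1 1 1 14054040; Term 1 1 2 18243225;
      Term 1 2 0 (-175890); Term 1 2 1 (-12162150); Term 1 3 0 439725;
      Term 2 0 1 3483480; Term 2 0 2 (-26756730); Term 2 1 1 20733570;
      Term 2 2 0 (-424710); Term 2 2 1 (-2027025); Term 2 3 0 315315;
      Term 3 0 1 (-4633200); Term 3 1 0 85800; Term 3 1 1 3783780;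
      Term 3 2 0 (-338910); Term 3 3 0 75075; Term 4 0 1 (-2505360);
      Term 4 1 0 102960; Term 4 2 0 (-90090); Term 5 1 0 34320]
  | 8 => [::
      Term 0 0 1 (-89080992); Term 0 0 2 (-63243180); Term 0 0 3 154702548;
      Term 0 0 4 1149323175; Term 0 1 1 (-527134608); Term 0 1 2 997620624;
      Term 0 1 3 (-3269185920); Term 0 2 1 (-1206377172);
      Term 0 2 2 3385456074; Term 0 3 1 (-1243674432); Term 0 4 0 1144143;
      Term 1 0 1 147603456; Term 1 0 2 147459312; Term 1 0 3 (-87567480);
      Term 1 1 0 (-96096); Term 1 1 1 751110360; Term 1 1 2 (-868863996);
      Term 1 1 3 (-510810300); Term 1 2 0 (-496496); Term 1 2 1 928791864;
      Term 1 2 2 817296480; Term 1 3 0 (-2062060); Term 1 3 1 (-352179828);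
      Term 1 4 0 2914912; Term 2 0 1 76540464; Term 2 0 2 (-416936520);
      Term 2 0 3 1123782660; Term 2 1 1 360007648; Term 2 1 2 (-2045187144);
      Term 2 2 0 (-76076); Term 2 2 1 1071206136; Term 2 2 2 85135050;
      Term 2 3 0 (-5581576); Term 2 3 1 (-60540480); Term 2 4 0 2716714;
      Term 3 0 1 (-215255040); Term 3 0 2 304864560; Term 3 1 0 336336;
      Term 3 1 1 (-533637104); Term 3 1 2 (-283783500); Term 3 2 0 2482480;
      Term 3 2 1 218450232; Term 3 3 0 (-5589584); Term 3 3 1 (-6306300);
      Term 3 4 0 1121120; Term 4 0 1 3747744; Term 4 0 2 302017716;
      Term 4 1 1 (-277701424); Term 4 2 0 3707704; Term 4 2 1 21441420;
      Term 4 3 0 (-2490488); Term 4 4 0 175175; Term 5 0 1 77453376;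
      Term 5 1 0 (-672672); Term 5 1 1 (-31815784); Term 5 2 0 2050048;
      Term 5 3 0 (-420420); Term 6 0 1 18594576; Term 6 1 0 (-576576);
      Term 6 2 0 404404; Term 7 1 0 (-144144)]
  | 10 => [::
      Term 0 0 1 (-10301316480); Term 0 0 2 (-22174326720);
      Term 0 0 3 64989664740; Term 0 0 4 (-43214551380);
      Term 0 0 5 (-31031725725); Term 0 1 1 (-56187462240);
      Term 0 1 2 (-1555428420); Term 0 1 3 28757956500;
      Term 0 1 4 141366750525; Term 0 2 1 (-117842437440);
      Term 0 2 2 141461725860; Term 0 2 3 (-263074601790);
      Term 0 3 1 (-134101733220); Term 0 3 2 231783822270;
      Term 0 4 1 (-79146960165); Term 0 5 0 10462725; Term 1 0 1 19322634240;
      Term 1 0 2 42638581440; Term 1 0 3 (-59222152080);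
      Term 1 0 4 19702683000; Term 1 1 0 (-1572480); Term 1 1 1 99790104960;
      Term 1 1 2 (-25718450940); Term 1 1 3 24956731800;
      Term 1 1 4 17239847625; Term 1 2 0 (-6683040); Term 1 2 1 160387161480;
      Term 1 2 2 (-133244535060); Term 1 2 3 (-50570219700);
      Term 1 3 0 (-14064960); Term 1 3 1 94773304080; Term 1 3 2 53326162890;
      Term 1 4 0 (-31946460); Term 1 4 1 (-19779980220); Term 1 5 0 29321565;
      Term 2 0 1 3198424320; Term 2 0 2 (-29938119120);
      Term 2 0 3 11241364680; Term 2 0 4 (-50570219700);
      Term 2 1 1 (-241441200); Term 2 1 2 (-67019982120);
      Term 2 1 3 161605784340; Term 2 2 0 (-960960); Term 2 2 1 45768313500;
      Term 2 2 2 (-200300880780); Term 2 2 3 (-3831077250);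
      Term 2 3 0 (-4264260); Term 2 3 1 89270574120; Term 2 3 2 6385128750;
      Term 2 4 0 (-93524340); Term 2 4 1 (-2833240410); Term 2 5 0 31981950;
      Term 3 0 1 (-25511915520); Term 3 0 2 14605194240;
      Term 3 0 3 (-7180533360); Term 3 1 0 5241600; Term 3 1 1 (-72221691360);
      Term 3 1 2 77186261880; Term 3 1 3 18389170800; Term 3 2 0 20682480;
      Term 3 2 1 (-76790357280); Term 3 2 2 (-33728074380);
      Term 3 3 0 69030780; Term 3 3 1 16910974080; Term 3 3 2 425675250;
      Term 3 4 0 (-107463720); Term 3 4 1 (-321621300); Term 3 5 0 17327310;
      Term 4 0 1 9744134400; Term 4 0 2 9010834560; Term 4 0 3 (-26567000460);
      Term 4 1 1 6227850720; Term 4 1 2 55877241420; Term 4 2 0 3123120;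
      Term 4 2 1 (-34411966680); Term 4 2 2 (-2383781400);
      Term 4 3 0 118099800; Term 4 3 1 1885944060; Term 4 4 0 (-61621560);
      Term 4 4 1 (-23648625); Term 4 5 0 4729725; Term 5 0 1 7682088960;
      Term 5 0 2 (-12317235840); Term 5 1 0 (-7338240);
      Term 5 1 1 19866974400; Term 5 1 2 5474048580; Term 5 2 0 (-41364960);
      Term 5 2 1 (-4689364680); Term 5 3 0 82893720; Term 5 3 1 126126000;
      Term 5 4 0 (-17837820); Term 5 5 0 525525; Term 6 0 1 (-2540603520);
      Term 6 0 2 (-4825220400); Term 6 1 1 5183309040; Term 6 2 0 (-46213440);
      Term 6 2 1 (-313212900); Term 6 3 0 27687660; Term 6 4 0 (-2102100);
      Term 7 0 1 (-1602881280); Term 7 1 0 7862400; Term 7 1 1 400239840;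
      Term 7 2 0 (-19808880); Term 7 3 0 3663660; Term 8 0 1 (-210712320);
      Term 8 1 0 5241600; Term 8 2 0 (-3123120); Term 9 1 0 1048320]
  | 12 => [::
      Term 0 0 1 (-2819720471040); Term 0 0 2 (-7268816263104);
      Term 0 0 3 16540215792408; Term 0 0 4 (-9901199824956);
      Term 0 0 5 4635844283070; Term 0 0 6 1024046948925;
      Term 0 1 1 (-14678284617216); Term 0 1 2 (-10822503729312);
      Term 0 1 3 29284534521792; Term 0 1 4 (-14947558674048);
      Term 0 1 5 (-6826979659500); Term 0 2 1 (-28547500205664);
      Term 0 2 2 4083123604428; Term 0 2 3 4802005933956;
      Term 0 2 4 19732138511085; Term 0 3 1 (-30170505874608);
      Term 0 3 2 25345780663104; Term 0 3 3 (-30329224373448);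
      Term 0 4 1 (-20405137967874); Term 0 4 2 24227520803343;
      Term 0 5 1 (-7827273254988); Term 0 6 0 140033223;
      Term 1 0 1 5820675784704; Term 1 0 2 15536774360448;
      Term 1 0 3 (-18028460997360); Term 1 0 4 7063880004720;
      Term 1 0 5 (-1755509055300); Term 1 1 0 (-58375680);
      Term 1 1 1 29622752260992; Term 1 1 2 10037815746552;
      Term 1 1 3 (-16950612880080); Term 1 1 4 1487486890890;
      Term 1 1 5 (-682697965950); Term 1 2 0 (-227234304);
      Term 1 2 1 49198169072448; Term 1 2 2 (-20736246663792);
      Term 1 2 3 11955368708712; Term 1 2 4 3185923841100;
      Term 1 3 0 (-394366368); Term 1 3 1 39418839896040;
      Term 1 3 2 (-25020972133740); Term 1 3 3 (-6016250740500);
      Term 1 4 0 (-455180880); Term 1 4 1 13741390294236;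
      Term 1 4 2 5344303628664; Term 1 5 0 (-649331166);
      Term 1 5 1 (-1832971472046); Term 1 6 0 420541308;
      Term 2 0 1 (-408705209088); Term 2 0 2 (-9656669331936);
      Term 2 0 3 (-1187648734536); Term 2 0 4 2967360831864;
      Term 2 0 5 2503225875150; Term 2 1 1 (-8407535203584);
      Term 2 1 2 (-5942876979600); Term 2 1 3 (-184307070816);
      Term 2 1 4 (-12271225026060); Term 2 2 0 (-27245504);
      Term 2 2 1 (-6872577642216); Term 2 2 2 (-10789687605312);
      Term 2 2 3 26339282201232; Term 2 2 4 189638323875;
      Term 2 3 0 (-110533280); Term 2 3 1 7382101230240;
      Term 2 3 2 (-27528372131832); Term 2 3 3 (-573129156600);
      Term 2 4 0 (-204384180); Term 2 4 1 11110929758874;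
      Term 2 4 2 615699114030; Term 2 5 0 (-2016208700);
      Term 2 5 1 (-230842796184); Term 2 6 0 510395743;
      Term 3 0 1 (-6802634539008); Term 3 0 2 1537748304576;
      Term 3 0 3 4539262340448; Term 3 0 4 (-918933135120);
      Term 3 1 0 192639744; Term 3 1 1 (-17457934778944);
      Term 3 1 2 11631513796056; Term 3 1 3 (-6258114761184);
      Term 3 1 4 (-1188400162950); Term 3 2 0 641705856;
      Term 3 2 1 (-23831167864592); Term 3 2 2 20389199939856;
      Term 3 2 3 3885398276760; Term 3 3 0 1119231960;
      Term 3 3 1 (-14469108519712); Term 3 3 2 (-4665810036888);
      Term 3 3 3 (-28094566500); Term 3 4 0 2174211600;
      Term 3 4 1 1972734119928; Term 3 4 2 48697248600;
      Term 3 5 0 (-2546503410); Term 3 5 1 (-22267545300);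
      Term 3 6 0 326894568; Term 4 0 1 4448724943872;
      Term 4 0 2 1189852872736; Term 4 0 3 (-954842024664);
      Term 4 0 4 2161355135940; Term 4 1 1 9085448515968;
      Term 4 1 2 274651401024; Term 4 1 3 (-7710733046016);
      Term 4 2 0 89392160; Term 4 2 1 2944177602696;
      Term 4 2 2 11103535877148; Term 4 2 3 219137618700;
      Term 4 3 0 314954640; Term 4 3 1 (-5710950186480);
      Term 4 3 2 (-410020130520); Term 4 4 0 4121412460;
      Term 4 4 1 204832678050; Term 4 4 2 2341213875;
      Term 4 5 0 (-1704233960); Term 4 5 1 (-1872971100);
      Term 4 6 0 118203085; Term 5 0 1 1059692249088;
      Term 5 0 2 (-1933646440704); Term 5 0 3 968342321232;
      Term 5 1 0 (-256852992); Term 5 1 1 4037583591360;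
      Term 5 1 2 (-5544484030008); Term 5 1 3 (-671486896080);
      Term 5 2 0 (-795837504); Term 5 2 1 5395335405856;
      Term 5 2 2 1368089442720; Term 5 3 0 (-2180683032);
      Term 5 3 1 (-768028446328); Term 5 3 2 (-19354034700);
      Term 5 4 0 3345609168; Term 5 4 1 15881605740; Term 5 5 0 (-645398754);
      Term 5 5 1 (-104053950); Term 5 6 0 23123100;
      Term 6 0 1 (-1384179413760); Term 6 0 2 266675211616;
      Term 6 0 3 773355118536; Term 6 1 1 (-1528270360320);
      Term 6 1 2 (-1873241617104); Term 6 2 0 (-118101984);
      Term 6 2 1 1312152951912; Term 6 2 2 71719928280;
      Term 6 3 0 (-2859595200); Term 6 3 1 (-61359986688);
      Term 6 4 0 1445393092; Term 6 4 1 797746950; Term 6 5 0 (-132352220);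
      Term 6 6 0 1926925; Term 7 0 1 (-117315551232); Term 7 0 2 517075289280;
      Term 7 1 0 192639744; Term 7 1 1 (-828614736576);
      Term 7 1 2 (-134293415256); Term 7 2 0 873928704;
      Term 7 2 1 126486179248; Term 7 3 0 (-1579643736);
      Term 7 3 1 (-2927164240); Term 7 4 0 329272944; Term 7 5 0 (-11561550);
      Term 8 0 1 162257306112; Term 8 0 2 103679269408;
      Term 8 1 1 (-127774103424); Term 8 2 0 789910880; Term 8 2 1 6110576472;
      Term 8 3 0 (-427062064); Term 8 4 0 31491460; Term 9 0 1 41333326848;
      Term 9 1 0 (-128426496); Term 9 1 1 (-6972350528); Term 9 2 0 277996224;
      Term 9 3 0 (-46774728); Term 10 0 1 3374114304; Term 10 1 0 (-70050816);
      Term 10 2 0 36603424; Term 11 1 0 (-11675136)]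
  | _ => [::]
  end%N.

Definition term_eval (a b c : Z) (t : term) : Z :=
  let: Term i j k z := t in
  z * ((a + b + c) ^+ i * ((a * b + b * c + c * a) ^+ j * (a * b * c) ^+ k)).

Definition area_poly (r : nat) (a b c : Z) : Z :=
  \sum_(t <- moment_table r) term_eval a b c t.

(** The binomial expansion of the mean of [(T + d)^r] at content [(a, b, c)], on the scale of the
    table. Indexing by [iota] lets [cbv] unfold the sum for a concrete [r]. *)
Definition shift_sum (r : nat) (a b c d : Z) : Z :=
  \sum_(j <- iota 0 r.+1) 'C(r, j)%:R * (d ^+ (r - j) * area_poly j a b c).

(** For each fixed [r] this is a polynomial identity over [Z], settled by [ring] once the table is
    unfolded. Since [a - 1] is subtraction in [Z], no case [a = 0] has to be set apart. *)
Lemma area_poly_rec (r : nat) (a b c : Z) : (r <= 12)%N ->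
  (a + b + c) * area_poly r a b c =
    a * shift_sum r (a - 1)%R b c (b - c)%R
    + b * shift_sum r a (b - 1)%R c (c - a)%R
    + c * shift_sum r a b (c - 1)%R (a - b)%R.
Proof.
do 13 (case: r => [_|r]; first by rewrite /shift_sum /area_poly !unlock;
  cbv [reducebig foldr comp applybig moment_table term_eval iota binomial
       addn addn_rec Nat.add subn subn_rec Nat.sub]; ring).
by [].
Qed.

(** * Values on the diagonal a = b = c *)

Ltac expand_area_poly :=
  rewrite /area_poly unlock;
  cbv [reducebig foldr comp applybig moment_table term_eval]; ring.

Lemma area_poly_const (x : Z) : area_poly 0 x x x = 135135%:R.
Proof. by expand_area_poly. Qed.

Lemma area_poly2 (x : Z) : area_poly 2 x x x = 135135%:R * x ^+ 2.
Proof. by expand_area_poly. Qed.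

Lemma area_poly4 (x : Z) : area_poly 4 x x x =
  x ^+ 3 * (567567%:R * x - 432432%:R).
Proof. by expand_area_poly. Qed.

Lemma area_poly6 (x : Z) : area_poly 6 x x x =
  x ^+ 3 * (5386095%:R * x ^+ 3 - 12664080%:R * x ^+ 2 + 9884160%:R * x
    - 2471040%:R).
Proof. by expand_area_poly. Qed.

Lemma area_poly8 (x : Z) : area_poly 8 x x x =
  x ^+ 3 * (92675583%:R * x ^+ 5 - 445404960%:R * x ^+ 4 + 878701824%:R * x ^+ 3
    - 878701824%:R * x ^+ 2 + 442810368%:R * x - 89945856%:R).
Proof. by expand_area_poly. Qed.

Lemma area_poly10 (x : Z) : area_poly 10 x x x =
  x ^+ 3 * (2542442175%:R * x ^+ 7 - 20701306080%:R * x ^+ 6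
    + 74375159040%:R * x ^+ 5 - 151373214720%:R * x ^+ 4
    + 187037061120%:R * x ^+ 3 - 139532440320%:R * x ^+ 2 + 57967902720%:R * x
    - 10315468800%:R).
Proof. by expand_area_poly. Qed.

Lemma area_poly12 (x : Z) : area_poly 12 x x x =
  x ^+ 3 * (102084219567%:R * x ^+ 9 - 1262299786704%:R * x ^+ 8
    + 7129644344064%:R * x ^+ 7 - 23956765265664%:R * x ^+ 6
    + 52423836512256%:R * x ^+ 5 - 77037163796736%:R * x ^+ 4
    + 75662614646784%:R * x ^+ 3 - 47703732240384%:R * x ^+ 2
    + 17462027354112%:R * x - 2820245852160%:R).
Proof. by expand_area_poly. Qed.

(** * Signed pair counts of a word over three letters *)

Definition o0 : 'I_3 := @Ordinal 3 0 isT.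
Definition o1 : 'I_3 := @Ordinal 3 1 isT.
Definition o2 : 'I_3 := @Ordinal 3 2 isT.

Lemma ord3P (x : 'I_3) : [\/ x = o0, x = o1 | x = o2].
Proof.
by case: x => [[|[|[|//]]] lt_x];
  [apply: Or31 | apply: Or32 | apply: Or33]; apply: val_inj.
Qed.

Fixpoint before (x y : 'I_3) (s : seq 'I_3) : nat :=
  if s is z :: s' then ((z == x) * count_mem y s' + before x y s')%N else 0%N.

Lemma before_cat x y s t :
  before x y (s ++ t) =
  (before x y s + before x y t + count_mem x s * count_mem y t)%N.
Proof. by elim: s => /= [|z s ->]; rewrite ?count_cat; nia. Qed.

Lemma before_rev x y s : before x y (rev s) = before y x s.
Proof.
elim: s => //= z s IHs; rewrite rev_cons -cats1 before_cat IHs /= count_rev.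
nia.
Qed.

Definition sgn_before (x y : 'I_3) (s : seq 'I_3) : Z :=
  (before x y s)%:R - (before y x s)%:R.

(** Read the letters as steps along three plane vectors with sum zero: up to a constant factor, this
    is the signed area between the resulting walk and its chord. *)
Definition area (s : seq 'I_3) : Z :=
  sgn_before o0 o1 s + sgn_before o1 o2 s + sgn_before o2 o0 s.

Lemma area_rev s : area (rev s) = - area s.
Proof. rewrite /area /sgn_before !before_rev; ring. Qed.

Definition content (s : seq 'I_3) : nat * nat * nat :=
  (count_mem o0 s, count_mem o1 s, count_mem o2 s).

(** A new first letter 1 precedes every 2, which raises A12, and every 3, which lowers A31. The
    change thus depends on the content alone, and this closes the recurrence on contents. The other
    two letters follow cyclically. *)
Lemma area_cons0 s :
  area (o0 :: s) = area s + ((count_mem o1 s)%:R - (count_mem o2 s)%:R).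
Proof. by rewrite /area /sgn_before /= !natrD !natrM /=; ring. Qed.

Lemma area_cons1 s :
  area (o1 :: s) = area s + ((count_mem o2 s)%:R - (count_mem o0 s)%:R).
Proof. by rewrite /area /sgn_before /= !natrD !natrM /=; ring. Qed.

Lemma area_cons2 s :
  area (o2 :: s) = area s + ((count_mem o0 s)%:R - (count_mem o1 s)%:R).
Proof. by rewrite /area /sgn_before /= !natrD !natrM /=; ring. Qed.

(** * Power sums of the area over the words of a given content *)

Lemma sum_ord3 (V : nmodType) (F : 'I_3 -> V) :
  \sum_x F x = F o0 + F o1 + F o2.
Proof.
rewrite !big_ord_recl big_ord0 addr0 addrA.
by congr (F _ + F _ + F _); apply: val_inj.
Qed.

Lemma sum_tuple_cons (V : nmodType) m (Q : pred (seq 'I_3)) (F : seq 'I_3 -> V) :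
  \sum_(w : m.+1.-tuple 'I_3 | Q w) F w =
  \sum_x \sum_(w : m.-tuple 'I_3 | Q (x :: w)) F (x :: w).
Proof.
rewrite pair_big_dep /=.
rewrite (reindex (fun p : 'I_3 * m.-tuple 'I_3 => [tuple of p.1 :: p.2])) //=.
exists (fun w => (thead w, [tuple of behead w])) => [[x w] _ | w _] /=.
  by congr (_, _); apply: val_inj.
by rewrite [RHS]tuple_eta; apply: val_inj.
Qed.

Definition area_sum (m r : nat) (k : nat * nat * nat) : Z :=
  \sum_(w : m.-tuple 'I_3 | content w == k) area w ^+ r.

(** The binomial theorem turns a shift of the area by [d] into [shift_sum]. The factor [K] will be
    the product of the content factorials with 135135, so that nothing is divided in [Z]. *)
Lemma shifted_area_sum m r k (d K a b c : Z) :
    (forall j, (j <= r)%N -> K * area_sum m j k = m`!%:R * area_poly j a b c) ->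
  K * (\sum_(w : m.-tuple 'I_3 | content w == k) (area w + d) ^+ r) =
  m`!%:R * shift_sum r a b c d.
Proof.
move=> area_sumE; rewrite /shift_sum -/(index_iota 0 r.+1) big_mkord.
under eq_bigr do rewrite addrC exprDn.
rewrite exchange_big /= !mulr_sumr; apply: eq_bigr => j _.
rewrite sumrMnl -mulr_sumr -mulr_natl -/(area_sum m j k).
transitivity ('C(r, j)%:R * (d ^+ (r - j) * (K * area_sum m j k))); first by ring.
by rewrite area_sumE -1?ltnS //; ring.
Qed.

(** One branch of the recurrence, shared by the three letters. Here [p] is the number of occurrences
    of the first letter; removing it lowers one factorial, whence [L = p * K]. *)
Lemma first_letter_sum m r x k k' (d p K L a b c : Z) :
    (forall s, (content (x :: s) == k) = (content s == k')) ->
    (forall s, content s = k' -> area (x :: s) = area s + d) ->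
    L = p * K ->
    (forall j, (j <= r)%N -> K * area_sum m j k' = m`!%:R * area_poly j a b c) ->
  L * (\sum_(w : m.-tuple 'I_3 | content (x :: w) == k) area (x :: w) ^+ r) =
  m`!%:R * (p * shift_sum r a b c d).
Proof.
move=> content_cons area_cons -> /(@shifted_area_sum _ _ _ d) shiftE.
rewrite -mulrA [RHS]mulrCA -shiftE; congr (_ * (_ * _)).
by apply: eq_big => // w; rewrite content_cons => /eqP/area_cons->.
Qed.

Lemma area_sum0 r : area_sum 0 r (0, 0, 0)%N = (r == 0)%:R.
Proof.
rewrite /area_sum (big_pred1 [tuple]) => [|w]; last by rewrite [w]tuple0 eqxx.
exact: expr0n.
Qed.

(** A binary literal, suited to the [vm_compute] in [area_poly0]. *)
Definition area_den : Z := Zpos 135135.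

Lemma area_poly0 r : (r <= 12)%N ->
  area_poly r 0 0 0 = area_den * (r == 0)%:R.
Proof.
do 13 (case: r => [|r]; first by rewrite /area_poly unlock; vm_compute).
by [].
Qed.

(** Since [m! / (a! b! c!)] counts the words of content [(a, b, c)], this gives the mean of [T^r],
    cleared of denominators. The induction on the length splits off the first letter, and
    [area_poly_rec] supplies the same recurrence on the polynomial side. *)
Lemma area_sumE m r a b c : (r <= 12)%N -> (a + b + c = m)%N ->
  (a`! * b`! * c`!)%:R * area_den * area_sum m r (a, b, c) =
  m`!%:R * area_poly r a%:R b%:R c%:R.
Proof.
elim: m r a b c => [|m IHm] r a b c r_le abc.
  have [-> [-> ->]] : a = 0%N /\ b = 0%N /\ c = 0%N by lia.
  by rewrite area_sum0 area_poly0 // !mul1r.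
rewrite {1}/area_sum (sum_tuple_cons _ _ (fun s => content s == (a, b, c))
  (fun s => area s ^+ r)) sum_ord3 /= !mulrDr.
(* The factor [m.+1 = a + b + c] of the factorial is the left factor in [area_poly_rec]. *)
rewrite factS [(m.+1 * _)%:R]natrM -[RHS]mulrA [RHS]mulrCA -abc !natrD.
rewrite area_poly_rec // !mulrDr.
have nat_pred (k : nat) : k.+1%:R - 1 = k%:R :> Z by rewrite -natr1 addrK.
congr (_ + _ + _).
(* If [a = 0], no word of this content starts with 1, and the factor [a] kills the polynomial side,
   whatever its value at [a - 1 = -1]. *)
- case: a abc => [|a] abc; first by rewrite big_pred0 ?mulr0 ?mul0r ?mulr0.
  rewrite nat_pred; pose K := (a`! * b`! * c`!)%:R * area_den.
  apply: (first_letter_sum _ _ _ _ (a, b, c) _ _ K) => // [s||].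
  + by move=> [_ <- <-]; exact: area_cons0.
  + by rewrite /K factS !natrM; move: area_den => D; ring.
  + by move=> j j_le; apply: IHm; lia.
- case: b abc => [|b] abc; first
    by rewrite big_pred0 ?mulr0 ?mul0r ?mulr0 // => w; rewrite !xpair_eqE andbF.
  rewrite nat_pred; pose K := (a`! * b`! * c`!)%:R * area_den.
  apply: (first_letter_sum _ _ _ _ (a, b, c) _ _ K) => // [s||].
  + by move=> [<- _ <-]; exact: area_cons1.
  + by rewrite /K factS !natrM; move: area_den => D; ring.
  + by move=> j j_le; apply: IHm; lia.
- case: c abc => [|c] abc; first
    by rewrite big_pred0 ?mulr0 ?mul0r ?mulr0 // => w; rewrite !xpair_eqE andbF.
  rewrite nat_pred; pose K := (a`! * b`! * c`!)%:R * area_den.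
  apply: (first_letter_sum _ _ _ _ (a, b, c) _ _ K) => // [s||].
  + by move=> [<- <- _]; exact: area_cons2.
  + by rewrite /K factS !natrM; move: area_den => D; ring.
  + by move=> j j_le; apply: IHm; lia.
Qed.

(** * Counting odd patterns by recursion on the word *)

Fixpoint pairs (Q : rel 'I_3) (s : seq 'I_3) : nat :=
  if s is y :: s' then (count (Q y) s' + pairs Q s')%N else 0%N.

Fixpoint triples (P : 'I_3 -> rel 'I_3) (s : seq 'I_3) : nat :=
  if s is x :: s' then (pairs (P x) s' + triples P s')%N else 0%N.

Lemma count_tnth m (Q : pred 'I_3) (w : m.-tuple 'I_3) :
  (\sum_(i < m) Q (tnth w i))%N = count Q w.
Proof.
rewrite -sum1_count big_tuple [RHS]big_mkcond.
by apply: eq_bigr => i _; case: (Q _).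
Qed.

Lemma pairs_tnth m (Q : rel 'I_3) (w : m.-tuple 'I_3) :
  (\sum_(i < m) \sum_(j < m) ((i < j) && Q (tnth w i) (tnth w j)))%N =
  pairs Q w.
Proof.
elim: m w => [|m IHm] w; first by rewrite big_ord0 [w]tuple0.
case/tupleP: w => y w; rewrite big_ord_recl big_ord_recl /= add0n; congr (_ + _)%N.
  by rewrite -count_tnth; apply: eq_bigr => j _; rewrite tnth0 tnthS.
rewrite -IHm; apply: eq_bigr => i _; rewrite big_ord_recl /= add0n.
by apply: eq_bigr => j _; rewrite !tnthS.
Qed.

Lemma triples_tnth m (P : 'I_3 -> rel 'I_3) (w : m.-tuple 'I_3) :
  (\sum_(i < m) \sum_(j < m) \sum_(k < m)
     [&& (i < j)%N, (j < k)%N & P (tnth w i) (tnth w j) (tnth w k)])%N =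
  triples P w.
Proof.
elim: m w => [|m IHm] w; first by rewrite big_ord0 [w]tuple0.
case/tupleP: w => x w; rewrite big_ord_recl big_ord_recl /=.
rewrite big1 ?add0n //; congr (_ + _)%N.
  rewrite -pairs_tnth; apply: eq_bigr => j _; rewrite big_ord_recl /= add0n.
  by apply: eq_bigr => k _; rewrite tnth0 !tnthS.
rewrite -IHm; apply: eq_bigr => i _; rewrite big_ord_recl /= big1 ?add0n //.
apply: eq_bigr => j _; rewrite big_ord_recl /= andbF add0n.
by apply: eq_bigr => k _; rewrite !tnthS.
Qed.

Definition odd_pattern (a b c : 'I_3) : bool :=
  [|| (a < c)%O && (c < b)%O, (b < a)%O && (a < c)%O | (c < b)%O && (b < a)%O].

(** Replaces position triples by a recursion on the list, so that [gep] can be treated by induction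
    on the word. *)
Lemma gep_triples m (w : m.-tuple 'I_3) : gep w = triples odd_pattern w.
Proof.
rewrite -triples_tnth !pair_bigA /gep cardsE -sum1_card big_mkcond /=.
by apply: eq_bigr => -[[i j] k] _; rewrite unfold_in /=; case: ifP.
Qed.

Lemma pairs_before (Q : rel 'I_3) x y s :
  (forall z t, Q z t = (z == x) && (t == y)) -> pairs Q s = before x y s.
Proof.
move=> QE; elim: s => //= z s ->; congr (_ + _)%N.
rewrite (eq_count (QE z)); case: (z == x); first by rewrite mul1n.
by rewrite mul0n count_pred0.
Qed.

(** The patterns 132, 213 and 321 start with different letters, so over three letters the first
    letter determines the ordered pair that must follow. *)
Lemma pairs_odd_pattern s :
  [/\ pairs (odd_pattern o0) s = before o2 o1 s,
      pairs (odd_pattern o1) s = before o0 o2 s &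
      pairs (odd_pattern o2) s = before o1 o0 s].
Proof.
by split; apply: pairs_before => z t;
  case: (ord3P z) => ->; case: (ord3P t) => ->.
Qed.

Lemma before_sym x y s : x != y ->
  (before x y s + before y x s = count_mem x s * count_mem y s)%N.
Proof.
move=> neq_xy; elim: s => //= z s.
have [->|] := eqVneq z x; first by rewrite (negPf neq_xy); nia.
by have [->|] := eqVneq z y; nia.
Qed.

(** Induction on the word. Prepending a 1 creates one odd pattern for each 3 before a 2, and twice
    that number is [b c - A23]. On the right, [a b c] grows by [b c] and [a A23] by [A23], while the
    changes [b c] of [c A12] and [- b c] of [b A31] cancel. The other letters are cyclic
    analogues. *)
Lemma double_triples s :
  (triples odd_pattern s)%:R *+ 2 =
  (count_mem o0 s * count_mem o1 s * count_mem o2 s)%:R -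
  ((count_mem o2 s)%:R * sgn_before o0 o1 s
   + (count_mem o0 s)%:R * sgn_before o1 o2 s
   + (count_mem o1 s)%:R * sgn_before o2 o0 s) :> Z.
Proof.
elim: s => //= x s IHs; rewrite natrD mulrnDl IHs /sgn_before /=.
(* Eliminates one of the two orders of a pair of letters, which leaves an identity for [ring]. *)
have beforeE y z : y != z -> (before y z s)%:R =
    (count_mem y s)%:R * (count_mem z s)%:R - (before z y s)%:R :> Z.
  by move=> neq_yz; rewrite -natrM -before_sym // natrD addrK.
have [pairs0 pairs1 pairs2] := pairs_odd_pattern s.
rewrite !natrD !natrM !natrD.
case: (ord3P x) => ->.
- by rewrite pairs0 (beforeE o2 o1) //=; ring.
- by rewrite pairs1 (beforeE o0 o2) //=; ring.
- by rewrite pairs2 (beforeE o1 o0) //=; ring.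
Qed.

(** * Rational means over the balanced words *)

Lemma area_denE : area_den = 135135%:R.
Proof. by rewrite /area_den; ring. Qed.

Lemma mem_balanced_words n (w : (3 * n).-tuple 'I_3) :
  (w \in balanced_words n) = (content w == (n, n, n)).
Proof.
rewrite inE; apply/forallP/eqP => [cnt | [c0 c1 c2] x].
  by congr (_, _, _); apply/eqP/cnt.
by case: (ord3P x) => ->; apply/eqP.
Qed.

Definition Zq (z : Z) : rat := (int_of_Z z)%:~R.

HB.instance Definition _ := GRing.RMorphism.copy Zq (intr \o int_of_Z).

Lemma sum_balanced_area n r :
  \sum_(w in balanced_words n) Zq (area w) ^+ r =
  Zq (area_sum (3 * n) r (n, n, n)).
Proof.
rewrite rmorph_sum; apply: eq_big => [w|w _]; first exact: mem_balanced_words.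
by rewrite rmorphXn.
Qed.

Lemma card_balanced_words n :
  #|balanced_words n|%:R = Zq (area_sum (3 * n) 0 (n, n, n)).
Proof.
by rewrite -sum_balanced_area; under eq_bigr do rewrite expr0; rewrite sumr_const.
Qed.

Lemma Zq_area_sum n r : (r <= 12)%N ->
  (n`! * n`! * n`!)%:R * 135135%:R * Zq (area_sum (3 * n) r (n, n, n)) =
  (3 * n)`!%:R * Zq (area_poly r n%:R n%:R n%:R).
Proof.
move=> r_le; have ZqM K D S M P : K * D * S = M * P ->
    Zq K * Zq D * Zq S = Zq M * Zq P.
  by rewrite -!rmorphM => ->.
have n3 : (n + n + n = 3 * n)%N by lia.
rewrite -(rmorph_nat Zq (_ * _ * _)) -(rmorph_nat Zq _`!) -(rmorph_nat Zq 135135).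
apply: ZqM; rewrite -area_denE; exact: area_sumE r_le n3.
Qed.

(** The case [r = 0] of [Zq_area_sum] expresses the cardinal through [(3n)!], which is nonzero; no
    balanced word has to be exhibited. *)
Lemma card_balanced_words_neq0 n : #|balanced_words n|%:R != 0 :> rat.
Proof.
rewrite card_balanced_words; apply/eqP => sum0.
have /esym/eqP := Zq_area_sum n 0 isT; rewrite sum0 mulr0 mulf_eq0 pnatr_eq0.
by rewrite eqn0Ngt fact_gt0 /= area_poly_const rmorph_nat => /eqP; lra.
Qed.

Definition area_mean n r : rat :=
  unif_mean (balanced_words n) (fun w => Zq (area w) ^+ r).

Lemma area_meanE n r : (r <= 12)%N ->
  area_mean n r = Zq (area_poly r n%:R n%:R n%:R) / 135135%:R.
Proof.
move=> r_le; rewrite /area_mean /unif_mean sum_balanced_area.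
have card_neq0 := card_balanced_words_neq0 n.
have K_neq0 : (n`! * n`! * n`!)%:R != 0 :> rat.
  by rewrite pnatr_eq0 -lt0n !muln_gt0 fact_gt0.
have D_neq0 : 135135%:R != 0 :> rat by rewrite pnatr_eq0.
have card_eq := Zq_area_sum n 0 isT.
rewrite -card_balanced_words area_poly_const rmorph_nat in card_eq.
(* From here on only the fact that 135135 is nonzero matters. *)
move: (135135%:R) D_neq0 card_eq (Zq_area_sum n r r_le) => D D_neq0 card_eq.
(* The multinomial count of the balanced words, read off from the case [r = 0]. *)
have -> : (3 * n)`!%:R = (n`! * n`! * n`!)%:R * #|balanced_words n|%:R :> rat.
  by apply: (mulIf D_neq0); rewrite -card_eq mulrAC.
rewrite -!mulrA => /(mulfI K_neq0) sum_eq.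
by apply/eqP; rewrite eqr_div // mulrC sum_eq mulrC.
Qed.

(** Reversal is an involution of the balanced words that negates the area, so the sum equals its own
    opposite. The table is not involved, hence [r] is unbounded. *)
Lemma area_mean_odd n r : odd r -> area_mean n r = 0.
Proof.
move=> r_odd; rewrite /area_mean /unif_mean.
suff -> : \sum_(w in balanced_words n) Zq (area w) ^+ r = 0 by rewrite mul0r.
set S := \sum_(w in _) _; suff : S = - S by lra.
rewrite {1}/S (reindex (fun w : (3 * n).-tuple 'I_3 => [tuple of rev w])) /=;
  last first.
  by exists (fun w : (3 * n).-tuple 'I_3 => [tuple of rev w]) => w _;
    apply: val_inj; rewrite /= revK.
rewrite /S -sumrN; apply: eq_big => [w|w _].
  by rewrite !mem_balanced_words /content /= !count_rev.
by rewrite /= area_rev rmorphN exprNn -signr_odd r_odd expr1 mulN1r.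
Qed.

(** * From the area to the Gepner statistic *)

Lemma gep_area n (w : (3 * n).-tuple 'I_3) : w \in balanced_words n ->
  (gep w)%:R = n%:R ^+ 3 / 2 - n%:R / 2 * Zq (area w) :> rat.
Proof.
rewrite mem_balanced_words => /eqP[c0 c1 c2].
have /(congr1 Zq) := double_triples w; rewrite c0 c1 c2 -gep_triples.
rewrite !natrM rmorphB rmorphMn !rmorphD !rmorphM !rmorph_nat.
(* All three weights in [double_triples] equal [n] here, so the weighted sum is [n] times the
   area. *)
rewrite /area !rmorphD => eq2; lra.
Qed.

Lemma gep_meanE n : gep_mean n = n%:R ^+ 3 / 2.
Proof.
rewrite /gep_mean /unif_mean (eq_bigr _ (gep_area n)) big_split /= sumr_const.
rewrite sumrN -mulr_sumr mulrDl mulNr -(mulrA (n%:R / 2)).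
(* The area itself has mean zero, being the odd case [r = 1]. *)
have := area_mean_odd n 1 isT; rewrite /area_mean /unif_mean.
under eq_bigr do rewrite expr1.
move=> ->; rewrite mulr0 oppr0 addr0 -[_ *+ #|_|]mulr_natr mulfK //.
exact: card_balanced_words_neq0.
Qed.

Lemma gep_momentE r n : gep_moment r n = (- (n%:R / 2)) ^+ r * area_mean n r.
Proof.
rewrite /gep_moment /area_mean /unif_mean gep_meanE mulrA mulr_sumr.
congr (_ / _); apply: eq_bigr => w /gep_area->.
by rewrite -exprMn; congr (_ ^+ _); ring.
Qed.

Theorem mainTheorem1 (n : nat) (hn : (1 <= n)%N) :
  let x : rat := n%:R in
  [/\ gep_mean n = x ^+ 3 / 2%:R,
      gep_moment 2 n = x ^+ 4 / 4%:R,
      (forall r : nat, (2 <= r)%N -> odd r -> gep_moment r n = 0),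
      gep_moment 4 n = 1 / 80%:R * x ^+ 7 * (21%:R * x - 16%:R) &
  [/\ gep_moment 6 n =
        1 / 448%:R * x ^+ 9 * (279%:R * x ^+ 3 - 656%:R * x ^+ 2 + 512%:R * x - 128%:R),
      gep_moment 8 n =
        1 / 1280%:R * x ^+ 11 *
          (3429%:R * x ^+ 5 - 16480%:R * x ^+ 4 + 32512%:R * x ^+ 3
             - 32512%:R * x ^+ 2 + 16384%:R * x - 3328%:R),
      gep_moment 10 n =
        1 / 11264%:R * x ^+ 13 * (3%:R * x - 4%:R) *
          (68985%:R * x ^+ 6 - 469716%:R * x ^+ 5 + 1391760%:R * x ^+ 4
             - 2251584%:R * x ^+ 3 + 2072832%:R * x ^+ 2 - 1022208%:R * x + 209920%:R) &
      gep_moment 12 n =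
        x ^+ 15 *
          (343717911%:R / 1863680%:R * x ^+ 9 - 265635477%:R / 116480%:R * x ^+ 8
             + 93771627%:R / 7280%:R * x ^+ 7 - 45012561%:R / 1040%:R * x ^+ 6
             + 43093563%:R / 455%:R * x ^+ 5 - 77940021%:R / 560%:R * x ^+ 4
             + 62196357%:R / 455%:R * x ^+ 3 - 39213532%:R / 455%:R * x ^+ 2
             + 14354176%:R / 455%:R * x - 463661%:R / 91%:R)]].
Proof.
move=> x.
(* In each even case the diagonal value of the table is substituted, and [field] cancels 135135 and
   the powers of 2. *)
have evenE r : (r <= 12)%N -> gep_moment r n =
    (- (x / 2)) ^+ r * (Zq (area_poly r n%:R n%:R n%:R) / 135135%:R).
  by move=> r_le; rewrite gep_momentE area_meanE.
split; last split.
- exact: gep_meanE.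
- by rewrite (evenE 2 isT) area_poly2 /Zq /x; field.
- by move=> r _ r_odd; rewrite gep_momentE area_mean_odd // mulr0.
- by rewrite (evenE 4 isT) area_poly4 /Zq /x; field.
- by rewrite (evenE 6 isT) area_poly6 /Zq /x; field.
- by rewrite (evenE 8 isT) area_poly8 /Zq /x; field.
- by rewrite (evenE 10 isT) area_poly10 /Zq /x; field.
- by rewrite (evenE 12 isT) area_poly12 /Zq /x; field.
Qed.
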